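(* Let $n\ge1$ be an integer. The outer measure $\boldsymbol{\kappa}:\mathcal{P}(\mathbb{R}^n)\to[0,1]$ given by $\boldsymbol{\kappa}(E)=2^{-\mathrm{K}(E)}$ is not globally optimal.
   Context: Here $\mathbb{N}=\{0,1,2,\ldots\}$. Fix a universal prefix Turing machine $U$ (the domain of a prefix machine is a prefix-free set of binary strings; universality gives, for each prefix machine $M$, a constant $c_M$ such that whenever $M(\pi)=w$ there is $\pi'$ with $U(\pi')=w$ and $|\pi'|\le|\pi|+c_M$). The prefix Kolmogorov complexity is $\mathrm{K}(w)=\min\{|\pi|\mid U(\pi)=w\}$, extended from binary strings to countable domains such as $\mathbb{Q}^n$ by fixed standard binary encodings. For $E\subseteq\mathbb{R}^n$, $\mathrm{K}(E)=\min\{\mathrm{K}(q)\mid q\in E\cap\mathbb{Q}^n\}$, with $\min\emptyset=\infty$, and $2^{-\infty}=0$. The function $\boldsymbol\kappa$ is an outer measure on $\mathbb{R}^n$. An outer measure on $\mathbb{R}^n$ is a function $\mu:\mathcal{P}(\mathbb{R}^n)\to[0,\infty]$ with $\mu(\emptyset)=0$ that is monotone and countably subadditive. It is *supported on $\mathbb{Q}^n$* if $\mu(\mathbb{R}^n\setminus\mathbb{Q}^n)=0$. It is *finitely supported on $\mathbb{Q}^n$* if for every $\varepsilon>0$ there is a finite set $A\subseteq\mathbb{Q}^n$ with $\mu(\mathbb{R}^n\setminus A)<\varepsilon$. It is *strongly finite* if it is supported on $\mathbb{Q}^n$ and $\sum_{q\in\mathbb{Q}^n}\mu(\{q\})<\infty$.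 It is *lower semicomputable* if it is finitely supported on $\mathbb{Q}^n$ and there is a computable function $\hat\mu:\mathcal{P}^{<\omega}(\mathbb{Q}^n)\times\mathbb{N}\to\mathbb{Q}\cap[0,\infty)$ (where $\mathcal{P}^{<\omega}(\mathbb{Q}^n)$ is the set of all finite subsets of $\mathbb{Q}^n$) such that for all finite $A\subseteq\mathbb{Q}^n$: (i) $\hat\mu(A,s)\le\hat\mu(A,t)\le\mu(A)$ whenever $s\le t$; (ii) $\lim_{t\to\infty}\hat\mu(A,t)=\mu(A)$. An outer measure $\mu$ on $\mathbb{R}^n$ is *globally optimal* if (i) $\mu$ is strongly finite and lower semicomputable, and (ii) for every strongly finite, lower semicomputable outer measure $\nu$ on $\mathbb{R}^n$ there is a constant $\beta\in(0,\infty)$ such that $\mu(E)\ge\beta\cdot\nu(E)$ for all $E\subseteq\mathbb{R}^n$. *)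

(* Defs.v *)
From HB Require Import structures.
From mathcomp Require Import all_boot all_order all_algebra.
From mathcomp Require Import finmap.
From mathcomp Require Import all_classical all_reals all_analysis.
Import Order.TTheory GRing.Theory Num.Theory.
Import numFieldNormedType.Exports.

Set Implicit Arguments.
Unset Strict Implicit.
Unset Printing Implicit Defensive.

Local Open Scope classical_set_scope.
Local Open Scope ring_scope.

(** Deterministic Turing machines with finitely many two-way infinite tapes.
    A cell contains [None] (blank), a bit [Some (inl b)], or a symbol
    [Some (inr a)] of the auxiliary alphabet of the machine. *)

Inductive move := MoveLeft | Stay | MoveRight.

Definition symbol (aux : Type) : Type := option (bool + aux).

Record turing_machine := TuringMachine {
  last_tape : nat; (* the tapes are numbered 0, ..., last_tape *)
  state : finType;
  aux : finType;
  start : state;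
  (* [None] means that the machine halts *)
  delta : state -> {ffun 'I_last_tape.+1 -> symbol aux} ->
    option (state * {ffun 'I_last_tape.+1 -> symbol aux * move}) }.

(** A tape is a pair [(l, r)]: [l] lists the cells to the left of the head,
    nearest first, and [r] the scanned cell followed by the cells to its right.
    All the cells that are not listed are blank. *)
Definition tape (aux : Type) : Type := (seq (symbol aux) * seq (symbol aux))%type.

Definition read aux (t : tape aux) : symbol aux := head None t.2.

Definition act aux (t : tape aux) (am : symbol aux * move) : tape aux :=
  let: (l, r) := (t.1, behead t.2) in
  match am.2 with
  | MoveLeft => (behead l, [:: head None l, am.1 & r])
  | Stay => (l, am.1 :: r)
  | MoveRight => (am.1 :: l, r)
  end.

Section Runs.
Variable M : turing_machine.

Definition config : Type :=
  (state M * {ffun 'I_(last_tape M).+1 -> tape (aux M)})%type.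

Definition step (c : config) : option config :=
  if delta c.1 [ffun i => read (c.2 i)] is Some (q, a)
  then Some (q, [ffun i => act (c.2 i) (a i)]) else None.

(** The input is on tape 0, the head on its first bit. *)
Definition initial (x : seq bool) : config :=
  (start M, [ffun i => if i == ord0 then ([::], [seq Some (inl b) | b <- x])
                       else ([::], [::])]).

Fixpoint leading_bits (s : seq (symbol (aux M))) : seq bool :=
  if s is Some (inl b) :: s' then b :: leading_bits s' else [::].

(** The output is the maximal string of bits on the last tape that starts at
    the head. *)
Definition output (c : config) : seq bool := leading_bits (c.2 ord_max).2.

Definition computes (x y : seq bool) : Prop :=
  exists (t : nat) (c : config),
    [/\ iter t (obind step) (Some (initial x)) = Some c,
        step c = None & output c = y].

Definition halts_on (x : seq bool) : Prop := exists y, computes x y.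

Definition prefix_machine : Prop :=
  forall x y, halts_on x -> halts_on y -> prefix x y -> x = y.

End Runs.

Definition universal_prefix_machine (U : turing_machine) : Prop :=
  prefix_machine U /\
  forall M, prefix_machine M -> exists c : nat, forall p w, computes M p w ->
    exists p', computes U p' w /\ (size p' <= size p + c)%N.

(** Binary digits, most significant first; [bits 0 = [:: false]]. *)
Definition bits (m : nat) : seq bool :=
  rev [seq odd (m %/ 2 ^ i) | i <- iota 0 (trunc_log 2 m).+1].

(** Every item of a list is preceded by [true], and [false] ends the list, so
    that a self-delimiting code of items gives a self-delimiting code of
    lists. *)
Definition enc_seq (T : Type) (enc : T -> seq bool) (s : seq T) : seq bool :=
  flatten [seq true :: enc x | x <- s] ++ [:: false].

Definition enc_nat (m : nat) : seq bool := enc_seq (fun b => [:: b]) (bits m).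

Definition enc_int (z : int) : seq bool := (z < 0) :: enc_nat `|z|%N.

Definition enc_rat (q : rat) : seq bool :=
  enc_int (numq q) ++ enc_nat `|denq q|%N.

Definition enc_point n (q : 'rV[rat]_n) : seq bool :=
  flatten [seq enc_rat (q ord0 i) | i <- enum 'I_n].

(** A finite set is presented to a machine by any list of its elements without
    repetition; the result must not depend on the list. *)
Definition computable n (f : {fset 'rV[rat]_n} -> nat -> rat) : Prop :=
  exists M, forall (A : {fset 'rV[rat]_n}) (s : seq 'rV[rat]_n) (t : nat),
    perm_eq s (enum_fset A) ->
    computes M (enc_seq (@enc_point n) s ++ enc_nat t) (enc_rat (f A t)).

(** The least element of a set of natural numbers; [None] is the infinite
    minimum of the empty set. *)
Definition min_nat (P : set nat) : option nat :=
  match pselect (exists k, `[<P k>]) with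
  | left exP => Some (ex_minn exP)
  | right _ => None
  end.

Definition K_string U (w : seq bool) : option nat :=
  min_nat [set k | exists p, computes U p w /\ size p = k].

Definition K_point U n (q : 'rV[rat]_n) : option nat :=
  K_string U (enc_point q).

Definition rat_point (R : realType) n (q : 'rV[rat]_n) : 'rV[R]_n :=
  map_mx ratr q.

Definition K_set U (R : realType) n (E : set 'rV[R]_n) : option nat :=
  min_nat [set k | exists q, E (rat_point R q) /\ K_point U q = Some k].

Definition kappa U (R : realType) n (E : set 'rV[R]_n) : \bar R :=
  if K_set U E is Some k then (2 ^- k)%:E else 0%E.

Section OuterMeasures.
Variables (R : realType) (n : nat).
Implicit Types mu : {outer_measure set 'rV[R]_n -> \bar R}.

Definition rat_fset (A : {fset 'rV[rat]_n}) : set 'rV[R]_n :=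
  @rat_point R n @` [set` A].

Definition supported_on_rat mu : Prop :=
  mu (~` range (@rat_point R n)) = 0%E.

Definition finitely_supported_on_rat mu : Prop :=
  forall e : R, 0 < e ->
    exists A : {fset 'rV[rat]_n}, (mu (~` rat_fset A) < e%:E)%E.

Definition strongly_finite mu : Prop :=
  supported_on_rat mu /\
  (\esum_(q in [set: 'rV[rat]_n]) mu [set rat_point R q] < +oo)%E.

Definition lower_semicomputable mu : Prop :=
  finitely_supported_on_rat mu /\
  exists muhat : {fset 'rV[rat]_n} -> nat -> rat,
    [/\ computable muhat,
        forall A t, 0 <= muhat A t,
        forall A s t, (s <= t)%N ->
          muhat A s <= muhat A t /\
          ((ratr (muhat A t))%:E <= mu (rat_fset A))%E
      & forall A, (ratr (muhat A t))%:E @[t --> \oo] --> mu (rat_fset A)].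

Definition globally_optimal mu : Prop :=
  [/\ strongly_finite mu, lower_semicomputable mu
    & forall nu : {outer_measure set 'rV[R]_n -> \bar R},
        strongly_finite nu -> lower_semicomputable nu ->
        exists beta : R, 0 < beta /\
          forall E : set 'rV[R]_n, (beta%:E * nu E <= mu E)%E].

End OuterMeasures.

Lemma min_natP (P : set nat) k :
  min_nat P = Some k <-> P k /\ forall j, P j -> (k <= j)%N.
Proof.
rewrite /min_nat; case: pselect => [exP|nP].
  case: ex_minnP => m /asboolP Pm mP; split=> [[<-]|[Pk kP]].
    by split=> // j Pj; apply: mP; apply/asboolP.
  by congr Some; apply/eqP; rewrite eqn_leq kP // mP //; apply/asboolP.
by split=> // -[Pk _]; case: nP; exists k; apply/asboolP.
Qed.

Lemma min_natN (P : set nat) : min_nat P = None <-> forall k, ~ P k.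
Proof.
rewrite /min_nat; case: pselect => [exP|nP].
  by split=> // nP; have [k /asboolP Pk] := exP; case: (nP k).
by split=> // _ k Pk; case: nP; exists k; apply/asboolP.
Qed.

Section KappaOuterMeasure.
Variables (U : turing_machine) (R : realType) (n : nat).
Local Notation kappa := (@kappa U R n).

Lemma kappa_ge0 E : (0 <= kappa E)%E.
Proof.
by rewrite /Defs.kappa; case: K_set => // k; rewrite lee_fin invr_ge0 exprn_ge0.
Qed.

Lemma kappa_le1 E : (kappa E <= 1)%E.
Proof.
rewrite /Defs.kappa; case: K_set => [k|]; rewrite lee_fin //.
by rewrite invf_le1 ?exprn_gt0 // exprn_ege1 // ler1n.
Qed.

Lemma kappa0 : kappa set0 = 0%E.
Proof.
rewrite /Defs.kappa /K_set.
by rewrite (iffRL (min_natN _)) // => k [q []].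
Qed.

Lemma le_kappa_witness (E F : set 'rV[R]_n) :
    (forall k, K_set U E = Some k ->
       exists q, F (rat_point R q) /\ K_point U q = Some k) ->
  (kappa E <= kappa F)%E.
Proof.
move=> EF; case EK: (K_set U E) => [k|]; last first.
  by rewrite {1}/Defs.kappa EK kappa_ge0.
have [q [Fq Kq]] := EF _ EK.
rewrite /Defs.kappa EK; case FK: (K_set U F) => [j|]; last first.
  by case: ((iffLR (min_natN _)) FK k); exists q.
have [_ jk] := (iffLR (min_natP _ _)) FK.
rewrite lee_fin lef_pV2 ?posrE ?exprn_gt0 // ler_weXn2l ?ler1n //.
by apply: jk; exists q.
Qed.

Lemma le_kappa : {homo kappa : E F / E `<=` F >-> (E <= F)%E}.
Proof.
move=> E F EF; apply: le_kappa_witness => k EK.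
have [[q [Eq Kq]] _] := (iffLR (min_natP _ _)) EK.
by exists q; split=> //; exact: EF.
Qed.

Lemma kappa_sigma_subadditive : sigma_subadditive kappa.
Proof.
move=> F; set S := \bigcup_i F i.
have S0 : (0 <= \sum_(i <oo) kappa (F i))%E.
  by apply: nneseries_ge0 => i _ _; exact: kappa_ge0.
case SK: (K_set U S) => [k|]; last by rewrite {1}/Defs.kappa SK.
have [[q [[i _ Fiq] Kq]] _] := (iffLR (min_natP _ _)) SK.
have le1 : (kappa S <= kappa (F i))%E.
  by apply: le_kappa_witness => j; rewrite SK => -[<-]; exists q.
apply: le_trans le1 _.
apply: le_trans (nneseries_lim_ge i.+1 _) => [|*]; last exact: kappa_ge0.
rewrite big_nat_recr //= leeDr // sume_ge0 // => j _; exact: kappa_ge0.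
Qed.

HB.instance Definition _ := isOuterMeasure.Build R 'rV[R]_n kappa
  kappa0 kappa_ge0 le_kappa kappa_sigma_subadditive.

End KappaOuterMeasure.

(* Main.v *)
Require Import Defs.
From HB Require Import structures.
From mathcomp Require Import all_boot all_order all_algebra.
From mathcomp Require Import finmap.
From mathcomp Require Import all_classical all_reals all_analysis.
From mathcomp Require Import ring lra zify.
Import Order.TTheory GRing.Theory Num.Theory.
Import numFieldNormedType.Exports.

Set Implicit Arguments.
Unset Strict Implicit.
Unset Printing Implicit Defensive.

Local Open Scope ring_scope.

(** [kappa E] depends only on the simplest point of [E], so it cannot see that
    [E] has many points. An additive outer measure can. Give a rational point
    the weight [2^-(1 + c)], where [c] is the number of bits in the code of the
    point that are not zero digits of a numerator. The integers (on the first
    axis) whose binary expansion is [1] followed by [2i] bits have total weight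
    [C (9/16)^i], and each weighs at most [C 4^-i]. At most [2^i] of them have
    complexity less than [i]; the others form a set [E_i] of weight at least
    [C ((9/16)^i - 2^-i) >= C i / 8 * 2^-i], whereas [kappa E_i <= 2^-i].
    The total weight is finite by a Kraft inequality for the automaton that
    reads the codes, and a Turing machine built on this automaton computes the
    weight of a finite set exactly, by adding binary fractions. *)

(** * Injectivity of the codes *)

Definition nat_of_bits (s : seq bool) : nat :=
  foldl (fun m (b : bool) => b + m.*2)%N 0%N s.

Definition mark (s : seq bool) : seq bool := flatten [seq [:: true; b] | b <- s].

Lemma nat_of_bits_rcons s b : nat_of_bits (rcons s b) = (b + (nat_of_bits s).*2)%N.
Proof. by rewrite /nat_of_bits foldl_rcons. Qed.

Lemma bits_double m (b : bool) : (0 < m)%N -> bits (b + m.*2) = rcons (bits m) b.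
Proof.
move=> m0; rewrite /bits.
have -> : trunc_log 2 (b + m.*2) = (trunc_log 2 m).+1.
  apply: trunc_log_eq => //; have /andP[lo hi] := trunc_log_bounds (isT : 1 < 2)%N m0.
  rewrite !expnS in lo hi *; case: b; lia.
rewrite -[iota 0 _.+2]/(0%N :: iota 1 _.+1) map_cons rev_cons expn0.
rewrite divn1; congr rcons; last first.
  by rewrite oddD odd_double addbF; case: b.
congr rev; rewrite (iotaDl 1 0) -map_comp; apply: eq_map => i /=.
by rewrite add1n expnS divnMA; congr (odd (_ %/ _)); case: b; lia.
Qed.

Lemma nat_of_bits_gt0 s : (0 < nat_of_bits (true :: s))%N.
Proof.
by elim/last_ind: s => // s b IHs; rewrite -rcons_cons nat_of_bits_rcons; case: b; lia.
Qed.

Lemma nat_of_bitsK s : bits (nat_of_bits (true :: s)) = true :: s.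
Proof.
elim/last_ind: s => [|s b IHs]; first by vm_compute.
by rewrite -rcons_cons nat_of_bits_rcons bits_double ?IHs // nat_of_bits_gt0.
Qed.

Lemma bitsK : cancel bits nat_of_bits.
Proof.
elim/ltn_ind => m IHm; have [m1|m1] := leqP m 1.
  by move: m1 {IHm}; case: m => [|[|m]] // _; vm_compute.
rewrite -[m in LHS]odd_double_half bits_double; last by lia.
by rewrite nat_of_bits_rcons IHm ?odd_double_half //; lia.
Qed.

Lemma bits_pos m : (0 < m)%N -> exists s, bits m = true :: s.
Proof.
elim/ltn_ind: m => m IHm m0; have [m1|m1] := leqP m 1.
  have -> : m = 1%N by lia.
  by exists [::].
have [s es] : exists s, bits m./2 = true :: s by apply: IHm; lia.
by exists (rcons s (odd m)); rewrite -[m in LHS]odd_double_half bits_double ?es //; lia.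
Qed.

Lemma bits_expn k : bits (2 ^ k) = true :: nseq k false.
Proof.
elim: k => [|k IHk]; first by vm_compute.
rewrite expnS mul2n -(add0n (_.*2)) (@bits_double _ false) ?expn_gt0 // IHk.
by rewrite -(addn1 k) nseqD -cats1.
Qed.

Lemma enc_natE m : enc_nat m = mark (bits m) ++ [:: false].
Proof. by []. Qed.

Lemma enc_rat_cat q y : enc_rat q ++ y =
  (numq q < 0) :: mark (bits `|numq q|) ++ false :: mark (bits `|denq q|) ++
  false :: y.
Proof. by rewrite /enc_rat /enc_int !enc_natE /= -!catA. Qed.

(** The markers show where the digits end, so the suffixes [x] and [y] can be arbitrary. With
    suffixes, concatenated codes can be peeled off one item at a time. *)
Lemma mark_inj s s' x y :
  mark s ++ false :: x = mark s' ++ false :: y -> s = s' /\ x = y.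
Proof.
elim: s s' => [|b s IHs] [|b' s'] //=; first by case.
by case=> -> /IHs [-> ->].
Qed.

Lemma enc_nat_inj a b x y : enc_nat a ++ x = enc_nat b ++ y -> a = b /\ x = y.
Proof.
by rewrite !enc_natE -!catA => /mark_inj[e ->]; split=> //; apply: (can_inj bitsK).
Qed.

Lemma enc_int_inj a b x y : enc_int a ++ x = enc_int b ++ y -> a = b /\ x = y.
Proof.
rewrite /enc_int !cat_cons => -[es] /enc_nat_inj[en ->]; split=> //.
by case: a b es en => [k|k] [l|l] //= _ [->].
Qed.

Lemma enc_rat_inj a b x y : enc_rat a ++ x = enc_rat b ++ y -> a = b /\ x = y.
Proof.
rewrite /enc_rat -!(catA (enc_int _)) => /enc_int_inj[en].
move=> /enc_nat_inj[ed ->]; split=> //.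
rewrite -(divq_num_den a) -(divq_num_den b) en; congr (_ / _%:~R).
by rewrite -(gez0_abs (ltW (denq_gt0 a))) ed gez0_abs // ltW ?denq_gt0.
Qed.

Lemma enc_point_inj n : injective (@enc_point n).
Proof.
move=> p q epq; apply/rowP => i; have := mem_enum 'I_n i; rewrite inE => iI.
move: epq; rewrite /enc_point; elim: (enum _) iI => //= j s IHs + /enc_rat_inj[ej es].
by rewrite inE => /predU1P[->//|/IHs]; apply.
Qed.

(** * Weights and the Kraft inequality *)

(** Phases of an automaton reading codes of rationals: [Num] and [Den] await a marker, [NumBit] and
    [DenBit] a digit. As [bits] is never empty, the first marker of a denominator is [true]; the
    separate phase [Den1] exploits this, and the factor 1/2 gained there pays for the free zero
    digits of the numerator. *)
Inductive phase := Sign | Num | NumBit | Den1 | Den | DenBit | Dead.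

Definition phases := [:: Sign; Num; NumBit; Den1; Den; DenBit; Dead].

Definition phase_code (f : phase) : nat :=
  match f with
  | Sign => 0 | Num => 1 | NumBit => 2 | Den1 => 3 | Den => 4 | DenBit => 5
  | Dead => 6
  end.

Lemma phase_codeK : cancel phase_code (nth Sign phases). Proof. by case. Qed.

HB.instance Definition _ := Countable.copy phase (can_type phase_codeK).

Lemma phase_enumP : Finite.axiom phases. Proof. by case. Qed.

HB.instance Definition _ := fintype.isFinite.Build phase phase_enumP.

Section Scanner.
Variable n : nat.

(* The counter is the number of coordinates that follow the current one. *)
Definition scanner : Type := ('I_n.+1 * phase)%type.

Definition scan (p : scanner) (b : bool) : option scanner :=
  let: (j, f) := p in
  match f with
  | Sign => Some (j, Num)
  | Num => Some (j, if b then NumBit else Den1)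
  | NumBit => Some (j, Num)
  | Den1 => Some (j, if b then DenBit else Dead)
  | Den => if b then Some (j, DenBit)
           else if j == ord0 then None else Some (inord j.-1, Sign)
  | DenBit => Some (j, Den)
  | Dead => Some (j, Dead)
  end.

(** A zero digit of a numerator is free but its marker is paid: up to a constant, the words of [m]
    digits have total weight [(3/4)^m], while none weighs more than [2^-m]. *)
Definition toll (p : scanner) (b : bool) : bool :=
  if p.2 is NumBit then b else true.

Fixpoint accepts (p : scanner) (x : seq bool) : bool :=
  if x is b :: y then
    if scan p b is Some p' then accepts p' y else nilp y
  else false.

Fixpoint cost (p : scanner) (x : seq bool) : nat :=
  if x is b :: y then
    (toll p b + if scan p b is Some p' then cost p' y else 0)%N
  else 0%N.

(* A supersolution of the Kraft recursion:
   potential p >= \sum_b 2^-(toll p b) * potential (scan p b). *)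
Definition potential (p : scanner) : rat :=
  match p.2 with NumBit => 3 / 2 | Den1 => 1 / 2 | Dead => 0 | _ => 1 end.

Definition weight (p : scanner) (x : seq bool) : rat := 2^-1 ^+ cost p x.

Lemma weight_ge0 p x : 0 <= weight p x.
Proof. by rewrite exprn_ge0. Qed.

Definition potential_next (p : scanner) (b : bool) : rat :=
  2^-1 ^+ toll p b * (if scan p b is Some p' then potential p' else 1).

Lemma potential_ge p :
  potential_next p true + potential_next p false <= potential p.
Proof.
rewrite /potential_next; case: p => j [] /=; rewrite /potential /=; try lra.
by case: ifP => _ /=; lra.
Qed.

(** Induction on a bound for the lengths: [S] is split by first bit, and the tails in each half are
    accepted from the next state, so [potential_ge] closes the recursion. *)
Lemma kraft p (S : seq (seq bool)) :
  uniq S -> all (accepts p) S -> \sum_(x <- S) weight p x <= potential p.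
Proof.
have [k Sk] : exists k, all (fun x => size x < k)%N S.
  by exists (\max_(x <- S) size x).+1; apply/allP => x xS; rewrite ltnS leq_bigmax_seq.
elim: k p S Sk => [|k IHk] p S Sk uS aS.
  case: S Sk {uS aS} => // _; rewrite big_nil.
  by case: p => j [] /=.
pose T b := [seq behead x | x <- S & head false x == b].
have S_cons b x : x \in S -> head false x == b -> x = b :: behead x.
  by move=> /(allP aS); case: x => //= c x _ /eqP ->.
have sumT b : \sum_(x <- S | head false x == b) weight p x =
    \sum_(y <- T b) weight p (b :: y).
  rewrite big_map big_filter big_seq_cond [RHS]big_seq_cond.
  by apply: eq_bigr => x /andP[xS xb]; rewrite -(S_cons b).
have memT b y : y \in T b -> b :: y \in S.
  by case/mapP=> x; rewrite mem_filter => /andP[xb xS] ->; rewrite -(S_cons b).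
have uT b : uniq (T b).
  rewrite map_inj_in_uniq ?filter_uniq // => x y; rewrite !mem_filter.
  move=> /andP[xb xS] /andP[yb yS] exy.
  by rewrite (S_cons b x) // (S_cons b y) // exy.
have leT b : \sum_(y <- T b) weight p (b :: y) <= potential_next p b.
  rewrite /weight /= /potential_next.
  under eq_bigr do rewrite exprD.
  rewrite -mulr_sumr ler_wpM2l ?exprn_ge0 //.
  case Ep': (scan p b) => [p'|].
    apply: IHk => //; apply/allP => y /memT yS.
      exact: (allP Sk _ yS).
    by have /= := allP aS _ yS; rewrite Ep'.
  (* Here the automaton stops after [b]: only the empty tail is accepted, so [T b] has at most one
     word, of weight 1. *)
  have: {subset T b <= [:: [::]]}.
    move=> y /memT /(allP aS) /=; rewrite Ep' inE; by case: y.
  move=> /(uniq_leq_size (uT b)).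
  by case: (T b) => [|? [|//]] _; rewrite ?big_nil ?big_seq1 ?expr0.
rewrite (bigID (fun x => head false x == true)) /= sumT.
under eq_bigl => x do rewrite eqb_id -eqbF_neg.
by rewrite sumT (le_trans _ (potential_ge p)) // lerD.
Qed.

Lemma accepts_num j s y : accepts (j, Num) (mark s ++ y) = accepts (j, Num) y.
Proof. by elim: s. Qed.

Lemma accepts_den j s y : accepts (j, Den) (mark s ++ y) = accepts (j, Den) y.
Proof. by elim: s. Qed.

Lemma cost_num j s y :
  cost (j, Num) (mark s ++ y) = (size s + count id s + cost (j, Num) y)%N.
Proof. by elim: s => //= b s ->; rewrite /toll; case: b => /=; lia. Qed.

Lemma accepts_enc_rat j q y :
  accepts (j, Sign) (enc_rat q ++ y) =
  if j == ord0 then nilp y else accepts (inord j.-1, Sign) y.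
Proof.
rewrite enc_rat_cat /= accepts_num /=.
(* A denominator has at least one digit, hence the automaton leaves [Den1] without falling into
   [Dead]. *)
have [|s ->] := @bits_pos `|denq q|%N; first by rewrite absz_gt0 denq_neq0.
by rewrite /= accepts_den /=; case: eqP.
Qed.

Lemma accepts_enc_rats (j : 'I_n.+1) (cs : seq rat) :
  size cs = j.+1 -> accepts (j, Sign) (flatten [seq enc_rat c | c <- cs]).
Proof.
elim: cs j => // c cs IHcs j [sz].
rewrite -[flatten _]/(enc_rat c ++ flatten [seq enc_rat c | c <- cs]).
rewrite accepts_enc_rat.
case: eqP => [j0|/eqP j0]; first by move: sz; rewrite j0; case: cs {IHcs}.
have j_gt0 : (0 < j)%N by rewrite lt0n.
by apply: IHcs; rewrite sz inordK ?prednK // ltnW.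
Qed.

Definition scan_start : scanner := (ord_max, Sign).

Lemma accepts_enc_point (q : 'rV[rat]_n.+1) : accepts scan_start (enc_point q).
Proof.
rewrite /enc_point (map_comp enc_rat (fun i => q ord0 i)) accepts_enc_rats //.
by rewrite size_map size_enum_ord.
Qed.

Definition nat_point (m : nat) : 'rV[rat]_n.+1 :=
  \row_i (if i == ord0 then m%:R else 0).

Lemma nat_point_inj : injective nat_point.
Proof.
move=> a b /rowP/(_ ord0); rewrite !mxE eqxx => /eqP.
by rewrite eqr_nat => /eqP.
Qed.

Lemma cost_nat_point : exists c, forall s,
  cost scan_start (enc_point (nat_point (nat_of_bits (true :: s)))) =
  (c + size s + count id s)%N.
Proof.
pose zeros := flatten [seq enc_rat 0 | _ <- enum 'I_n].
pose tail := false :: mark (bits 1) ++ false :: zeros.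
(* The 3 pays for the sign, the first marker and the leading digit 1; all that follows the numerator
   is the same for every [s]. *)
exists (3 + cost (ord_max, Num) tail)%N => s.
have -> : enc_point (nat_point (nat_of_bits (true :: s))) =
    enc_rat (nat_of_bits (true :: s))%:R ++ zeros.
  rewrite /enc_point enum_ordSl map_cons -map_comp.
  congr (enc_rat _ ++ flatten _); first by rewrite mxE.
  by apply: eq_map => i /=; rewrite mxE.
rewrite enc_rat_cat pmulrn numq_int denq_int absz_nat nat_of_bitsK.
rewrite -[false :: mark (bits _) ++ _]/tail [LHS]/= -/(mark s) cost_num /toll /=.
by lia.
Qed.

End Scanner.

(** * A machine that adds weights *)

(* Tape 0 is the input. Tape 1 holds a binary fraction: the home cell, then the
   digits of [1/2, 1/4, ...]. Reading the code of a point moves the head of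
   tape 1 from home to the place of the weight of the point, where [Incr] adds a
   unit. The final fraction is encoded on tape 2 from right to left: [Trim] deletes
   the trailing zeros, which makes the fraction irreducible; [DenMark], [DenZero]
   and [DenOne] write the denominator; [Strip] deletes the leading zeros; [Digit]
   and [Mark] write the numerator. *)
Inductive control :=
  | Init | Item | Incr | Home | ToEnd | Trim | DenMark | DenZero | DenOne
  | NumEnd | Strip | ToLast | Digit | Mark | Halt.

Definition controls :=
  [:: Init; Item; Incr; Home; ToEnd; Trim; DenMark; DenZero; DenOne;
      NumEnd; Strip; ToLast; Digit; Mark; Halt].

Definition control_code (c : control) : nat :=
  match c with
  | Init => 0 | Item => 1 | Incr => 2 | Home => 3 | ToEnd => 4 | Trim => 5
  | DenMark => 6 | DenZero => 7 | DenOne => 8 | NumEnd => 9 | Strip => 10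
  | ToLast => 11 | Digit => 12 | Mark => 13 | Halt => 14
  end.

Lemma control_codeK : cancel control_code (nth Init controls).
Proof. by case. Qed.

HB.instance Definition _ := Countable.copy control (can_type control_codeK).

Lemma control_enumP : Finite.axiom controls. Proof. by case. Qed.

HB.instance Definition _ := fintype.isFinite.Build control control_enumP.

Definition bit_cell (b : bool) : symbol unit := Some (inl b).
Definition home_cell : symbol unit := Some (inr tt).
Definition bit_cells (s : seq bool) : seq (symbol unit) := map bit_cell s.
Definition blanks k : seq (symbol unit) := nseq k None.

Section Machine.
Variable n : nat.

Definition wstate : Type := (scanner n + control)%type.

Definition waction : Type :=
  (wstate * (symbol unit * move) * (symbol unit * move) * (symbol unit * move))%type.

(* A blank cell of tape 1 stands for the digit 0. *)
Definition digit (y : symbol unit) : symbol unit :=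
  if y is None then bit_cell false else y.

Definition wdelta (q : wstate) (x y z : symbol unit) : option waction :=
  match q with
  | inl p =>
    if x is Some (inl b) then
      Some (if scan p b is Some p' then inl p' else inr Incr, (x, MoveRight),
            (digit y, if toll p b then MoveRight else Stay), (z, Stay))
    else None
  | inr Init => Some (inr Item, (x, Stay), (home_cell, Stay), (z, Stay))
  | inr Item =>
    if x is Some (inl true)
    then Some (inl (scan_start n), (x, MoveRight), (y, MoveRight), (z, Stay))
    else Some (inr ToEnd, (x, Stay), (y, Stay), (z, Stay))
  | inr Incr =>
    if y is Some (inl true)
    then Some (inr Incr, (x, Stay), (bit_cell false, MoveLeft), (z, Stay))
    else Some (inr Home, (x, Stay), (bit_cell true, Stay), (z, Stay))
  | inr Home =>
    if y is Some (inr _)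
    then Some (inr Item, (x, Stay), (y, Stay), (z, Stay))
    else Some (inr Home, (x, Stay), (y, MoveLeft), (z, Stay))
  | inr ToEnd =>
    if y is None
    then Some (inr Trim, (x, Stay), (y, MoveLeft), (z, Stay))
    else Some (inr ToEnd, (x, Stay), (y, MoveRight), (z, Stay))
  | inr Trim =>
    if y is Some (inl false)
    then Some (inr Trim, (x, Stay), (None, MoveLeft), (z, Stay))
    else Some (inr DenMark, (x, Stay), (y, Stay), (bit_cell false, MoveLeft))
  | inr DenMark =>
    if y is Some (inl _)
    then Some (inr DenZero, (x, Stay), (y, Stay), (bit_cell false, MoveLeft))
    else Some (inr DenOne, (x, Stay), (y, Stay), (bit_cell true, MoveLeft))
  | inr DenZero =>
    Some (inr DenMark, (x, Stay), (y, MoveLeft), (bit_cell true, MoveLeft))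
  | inr DenOne =>
    Some (inr NumEnd, (x, Stay), (y, Stay), (bit_cell true, MoveLeft))
  | inr NumEnd =>
    Some (inr Strip, (x, Stay), (y, MoveRight), (bit_cell false, MoveLeft))
  | inr Strip =>
    match y with
    | Some (inl false) => Some (inr Strip, (x, Stay), (None, MoveRight), (z, Stay))
    | None => Some (inr Digit, (x, Stay), (bit_cell false, Stay), (z, Stay))
    | _ => Some (inr ToLast, (x, Stay), (y, Stay), (z, Stay))
    end
  | inr ToLast =>
    if y is None
    then Some (inr Digit, (x, Stay), (y, MoveLeft), (z, Stay))
    else Some (inr ToLast, (x, Stay), (y, MoveRight), (z, Stay))
  | inr Digit =>
    if y is Some (inl _)
    then Some (inr Mark, (x, Stay), (y, Stay), (y, MoveLeft))
    else Some (inr Halt, (x, Stay), (y, Stay), (bit_cell false, Stay))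
  | inr Mark => Some (inr Digit, (x, Stay), (y, MoveLeft), (bit_cell true, MoveLeft))
  | inr Halt => None
  end.

Definition cells3 T (a b c : T) : {ffun 'I_3 -> T} :=
  [ffun i : 'I_3 => nth c [:: a; b] i].

Definition weight_machine : turing_machine :=
  @TuringMachine 2 wstate unit (inr Init) (fun q r =>
    if wdelta q (r ord0) (r (inord 1)) (r (inord 2)) is Some (q', a, b, c)
    then Some (q', cells3 a b c) else None).

Definition conf (q : wstate) (t0 t1 t2 : tape unit) : config weight_machine :=
  (q, cells3 t0 t1 t2).

Definition run (c c' : config weight_machine) : Prop :=
  exists t, iter t (obind (@step weight_machine)) (Some c) = Some c'.

Lemma step_conf q t0 t1 t2 : step (conf q t0 t1 t2) =
  if wdelta q (read t0) (read t1) (read t2) is Some (q', a, b, c)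
  then Some (conf q' (act t0 a) (act t1 b) (act t2 c)) else None.
Proof.
rewrite /step /= !ffunE !inordK //=.
case: wdelta => // -[[[q' a] b] c]; congr (Some (_, _)).
apply/ffunP => i; rewrite !ffunE.
by case: i => -[|[|[|//]]] ?.
Qed.

Lemma run_refl c : run c c. Proof. by exists 0%N. Qed.

Lemma run_trans c1 c2 c3 : run c1 c2 -> run c2 c3 -> run c1 c3.
Proof. by move=> [s r12] [t r23]; exists (t + s)%N; rewrite iterD r12. Qed.

Lemma run_step q t0 t1 t2 q' a b c c' :
  wdelta q (read t0) (read t1) (read t2) = Some (q', a, b, c) ->
  run (conf q' (act t0 a) (act t1 b) (act t2 c)) c' -> run (conf q t0 t1 t2) c'.
Proof.
move=> d; apply: run_trans; exists 1%N; rewrite /= step_conf d.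
by [].
Qed.


(** Writing back a blank on an empty right part would list that blank, so the two tapes would differ
    as lists. *)
Lemma act_keep (t : tape unit) : t.2 != [::] -> act t (read t, Stay) = t.
Proof. by case: t => l []. Qed.

(** The output grows from right to left; the head waits on the blank just before it. *)
Definition written (o : seq bool) : tape unit := ([::], None :: bit_cells o).

Lemma act_written o b : act (written o) (bit_cell b, MoveLeft) = written (b :: o).
Proof. by []. Qed.

(** * Arithmetic of binary fractions and its execution on tape 1 *)

Fixpoint frac (s : seq bool) : rat :=
  if s is b :: s' then (b%:R + frac s') / 2 else 0.

Lemma frac_cat s t : frac (s ++ t) = frac s + 2^-1 ^+ size s * frac t.
Proof.
elim: s => [|b s IHs] /=; first by rewrite add0r mul1r.
by rewrite IHs exprS; field.
Qed.

Lemma frac_ge0 s : 0 <= frac s.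
Proof. by elim: s => //= b s IHs; rewrite divr_ge0 // addr_ge0. Qed.

Lemma frac_nseq0 k : frac (nseq k false) = 0.
Proof. by elim: k => //= k ->; rewrite add0r mul0r. Qed.

(* Lists of digits that are scanned leftwards have the last digit first. *)
Fixpoint incr (a : seq bool) : seq bool :=
  if a is b :: a' then (if b then false :: incr a' else true :: a') else [::].

Lemma size_incr a : size (incr a) = size a.
Proof. by elim: a => //= -[] a //= ->. Qed.

(** The carry stops at the last zero digit of the fraction; without a zero it would overflow. *)
Lemma frac_incr a :
  false \in a -> frac (rev (incr a)) = frac (rev a) + 2^-1 ^+ size a.
Proof.
elim: a => // b a IHa; rewrite inE /=; case: b => /= [/IHa ea|_];
  rewrite !rev_cons -!cats1 !frac_cat ?size_rev ?ea /= exprS; last by field.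
by rewrite size_incr; field.
Qed.

Lemma frac_ones a : false \notin a -> frac (rev a) = 1 - 2^-1 ^+ size a.
Proof.
elim: a => [|b a IHa]; first by rewrite subrr.
rewrite inE negb_or => /andP[b1 /IHa ea].
by rewrite rev_cons -cats1 frac_cat size_rev ea /= exprS; case: b b1 => // _ /=; field.
Qed.

Section Steady.
Variables t0 t2 : tape unit.
Hypotheses (t0_steady : t0.2 != [::]) (t2_steady : t2.2 != [::]).

Let runsK := (act_keep t0_steady, act_keep t2_steady).

Lemma home_run a b r :
  run (conf (inr Home) t0 (bit_cells a ++ [:: home_cell], bit_cells (b :: r)) t2)
      (conf (inr Item) t0 ([::], home_cell :: bit_cells (rev a ++ b :: r)) t2).
Proof.
elim: a b r => [|c a IHa] b r; (apply: run_step; first by []); rewrite !runsK /act /=.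
  by apply: run_step; first by []; rewrite !runsK /act /=; apply: run_refl.
by rewrite rev_cons cat_rcons; exact: (IHa c (b :: r)).
Qed.

(** The zero in [b :: a] stops the carry before the home cell. The list [r] may be empty or start
    with a blank, which [digit] turns into the digit 0. *)
Lemma incr_run a b r c :
    digit (head None r) = bit_cell b -> behead r = bit_cells c ->
    false \in b :: a ->
  run (conf (inr Incr) t0 (bit_cells a ++ [:: home_cell], r) t2)
      (conf (inr Item) t0
         ([::], home_cell :: bit_cells (rev (incr (b :: a)) ++ c)) t2).
Proof.
elim: a b r c => [|d a IHa] b r c rb rc; case: b rb => // rb.
- move=> _; apply: (@run_step _ _ _ _ (inr Home) (read t0, Stay)
    (bit_cell true, Stay) (read t2, Stay)).
    by case: r rb {rc} => [|[[[]|]|] r].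
  rewrite !runsK /act /= rc; exact: (home_run [::] true).
- rewrite inE /= => da; apply: (@run_step _ _ _ _ (inr Incr) (read t0, Stay)
    (bit_cell false, MoveLeft) (read t2, Stay)).
    by case: r rb {rc} => [|[[[]|]|] r].
  rewrite !runsK /act /= rev_cons cat_rcons.
  by apply: IHa => //=; rewrite rc.
- move=> _; apply: (@run_step _ _ _ _ (inr Home) (read t0, Stay)
    (bit_cell true, Stay) (read t2, Stay)).
    by case: r rb {rc} => [|[[[]|]|] r].
  rewrite !runsK /act /= rc [rev (true :: _)]rev_cons cat_rcons.
  exact: (home_run (d :: a) true).
Qed.

End Steady.

(** Reading [x] moves the head of tape 1 by the cost of [x] and at most pads the digits with zeros,
    so the fraction keeps its value. *)
Lemma scan_run p x y l a r t2 : t2.2 != [::] -> accepts p x ->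
  exists l' a' r',
  [/\ run (conf (inl p) (l, bit_cells (x ++ y))
            (bit_cells a ++ [:: home_cell], bit_cells r) t2)
        (conf (inr Incr) (l', bit_cells y)
            (bit_cells a' ++ [:: home_cell], bit_cells r') t2),
      size a' = (cost p x + size a)%N
    & frac (rev a' ++ r') = frac (rev a ++ r)].
Proof.
move=> t2K; elim: x p l a r => // b x IHx p l a r /= accx.
pose a1 := if toll p b then head false r :: a else a.
pose r1 := if toll p b then behead r else head false r :: behead r.
have e1 : frac (rev a1 ++ r1) = frac (rev a ++ r).
  rewrite /a1 /r1; case: toll; rewrite ?rev_cons ?cat_rcons;
  by case: r {a1 r1} => //; rewrite !frac_cat /= ?addr0 ?mul0r.
have step1 : run (conf (inl p) (l, bit_cells (b :: x ++ y))
      (bit_cells a ++ [:: home_cell], bit_cells r) t2)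
    (conf (if scan p b is Some p' then inl p' else inr Incr)
      (bit_cell b :: l, bit_cells (x ++ y))
      (bit_cells a1 ++ [:: home_cell], bit_cells r1) t2).
  apply: run_step; first by [].
  rewrite (act_keep t2K) /a1 /r1; case: toll; case: r {a1 r1 e1} => [|c r] /=;
  exact: run_refl.
have sz1 : size a1 = (toll p b + size a)%N by rewrite /a1; case: toll.
case Ep': (scan p b) accx step1 => [p'|] accx step1.
  have [l' [a' [r' [run' sz' e']]]] := IHx p' (bit_cell b :: l) a1 r1 accx.
  exists l', a', r'; split; [exact: run_trans step1 run'| |by rewrite e' e1].
  by rewrite sz' sz1; lia.
case: x accx step1 {IHx} => // _ step1.
by exists (bit_cell b :: l), a1, r1; rewrite addn0.
Qed.

Lemma item_run x b y l L t2 : t2.2 != [::] -> accepts (scan_start n) x ->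
    frac L + 2^-1 * weight (scan_start n) x < 1 ->
  exists l' L',
    run (conf (inr Item) (l, bit_cells (true :: x ++ b :: y))
           ([::], home_cell :: bit_cells L) t2)
        (conf (inr Item) (l', bit_cells (b :: y))
           ([::], home_cell :: bit_cells L') t2) /\
    frac L' = frac L + 2^-1 * weight (scan_start n) x.
Proof.
move=> t2K accx lt1.
have [l' [a [r [run1 sz e]]]] :=
  scan_run (b :: y) (bit_cell true :: l) [::] L t2K accx.
rewrite addn0 in sz.
pose c := head false r.
have ec : frac (rev (c :: a) ++ behead r) = frac L.
  rewrite rev_cons cat_rcons -[RHS]e /c.
  by case: (r) => //; rewrite !frac_cat /= ?addr0 ?mul0r.
(* The head has passed [cost] digits and scans the next one, whence the additional factor 1/2. *)
have ew : 2^-1 * weight (scan_start n) x = 2^-1 ^+ size (c :: a).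
  by rewrite /weight -sz exprS.
(* If the digits up to the head were all ones, adding a unit in the last of these places would reach
   1, against [lt1]. *)
have has0 : false \in c :: a.
  apply: contraLR lt1 => /frac_ones ones; rewrite -leNgt -ec frac_cat ones ew.
  have := frac_ge0 (behead r).
  have : 0 <= 2^-1 ^+ size (rev (c :: a)) :> rat by rewrite exprn_ge0.
  by move=> p0 q0; have := mulr_ge0 p0 q0; lra.
exists l', (rev (incr (c :: a)) ++ behead r); split.
  apply: run_step; first by [].
  rewrite (act_keep t2K); apply: (run_trans run1).
  apply: incr_run => //; first by rewrite /c; case: (r).
  by case: (r).
rewrite -ec ew !frac_cat frac_incr // !size_rev.
by rewrite size_incr; ring.
Qed.

End Machine.

(** * Writing the final fraction as the code of a rational *)

Section Output.
Variables (n : nat) (t0 : tape unit).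
Hypothesis t0_steady : t0.2 != [::].

Let keep0 := act_keep t0_steady.

(* The head is on the first item of [a], or on the home cell if [a] is empty. *)
Definition at_top (a : seq bool) (r : seq (symbol unit)) : tape unit :=
  if a is b :: a' then (bit_cells a' ++ [:: home_cell], bit_cell b :: r)
  else ([::], home_cell :: r).

Lemma act_left a r y :
  act (bit_cells a ++ [:: home_cell], r) (y, MoveLeft) = at_top a (y :: behead r).
Proof. by case: a. Qed.

Lemma keep_written o : act (written o) (read (written o), Stay) = written o.
Proof. by []. Qed.

Local Notation conf := (@conf n).
Local Notation run := (@run n).

Lemma toend_run a s t2 : t2.2 != [::] ->
  run (conf (inr ToEnd) t0 (bit_cells a ++ [:: home_cell], bit_cells s) t2)
      (conf (inr Trim) t0 (at_top (rev s ++ a) (blanks 1)) t2).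
Proof.
move=> t2K; elim: s a => [|b s IHs] a; (apply: run_step; first by []);
  rewrite keep0 (act_keep t2K).
  by rewrite act_left; exact: run_refl.
by rewrite rev_cons cat_rcons; exact: (IHs (b :: a)).
Qed.

(** The default in [head true a'] admits the empty list, which is what remains of the fraction 0. *)
Lemma trim_run a k t2 : t2.2 != [::] -> exists z a' k',
  [/\ a = nseq z false ++ a', head true a' &
  run (conf (inr Trim) t0 (at_top a (blanks k.+1)) t2)
      (conf (inr Trim) t0 (at_top a' (blanks k'.+1)) t2)].
Proof.
move=> t2K; elim: a k => [|[] a IHa] k.
- by exists 0%N, [::], k; split=> //; exact: run_refl.
- by exists 0%N, (true :: a), k; split=> //; exact: run_refl.
have [z [a' [k' [-> a'1 run']]]] := IHa k.+1.
exists z.+1, a', k'; split=> //; apply: run_trans run'.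
apply: run_step; first by [].
by rewrite keep0 (act_keep t2K) act_left; exact: run_refl.
Qed.

(** The denominator is a one followed by as many zeros as there are digits left, so each digit
    passed yields one marked zero. *)
Lemma denominator_run a r o :
  run (conf (inr DenMark) t0 (at_top a r) (written o))
      (conf (inr DenMark) t0 ([::], home_cell :: bit_cells (rev a) ++ r)
         (written (mark (nseq (size a) false) ++ o))).
Proof.
elim: a r o => [|b a IHa] r o; first exact: run_refl.
apply: run_step; first by [].
rewrite keep0 ?keep_written act_written.
apply: run_step; first by [].
rewrite keep0 [at_top (b :: a) r]/= act_left act_written.
have := IHa (bit_cell b :: r) (true :: false :: o).
rewrite rev_cons -cats1 /bit_cells map_cat -catA /=.
have -> // : mark (nseq (size a) false) ++ [:: true, false & o] =
  [:: true, false & mark (nseq (size a) false) ++ o].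
by elim: (size a) => //= k ->.
Qed.

Lemma strip_run s j r t2 : t2.2 != [::] -> exists z d j',
  [/\ s = nseq z false ++ d, head true d &
  run (conf (inr Strip) t0 (blanks j ++ [:: home_cell], bit_cells s ++ r) t2)
      (conf (inr Strip) t0 (blanks j' ++ [:: home_cell], bit_cells d ++ r) t2)].
Proof.
move=> t2K; elim: s j => [|[] s IHs] j.
- by exists 0%N, [::], j; split=> //; exact: run_refl.
- by exists 0%N, (true :: s), j; split=> //; exact: run_refl.
have [z [d [j' [-> d1 run']]]] := IHs j.+1.
exists z.+1, d, j'; split=> //; apply: run_trans run'.
apply: run_step; first by [].
by rewrite keep0 (act_keep t2K); exact: run_refl.
Qed.

Lemma tolast_run l a d k t2 : t2.2 != [::] ->
  run (conf (inr ToLast) t0 (bit_cells a ++ l, bit_cells d ++ blanks k) t2)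
      (conf (inr ToLast) t0 (bit_cells (rev d ++ a) ++ l, blanks k) t2).
Proof.
move=> t2K; elim: d a => [|b d IHd] a; first exact: run_refl.
apply: run_step; first by [].
rewrite keep0 (act_keep t2K) rev_cons cat_rcons; exact: (IHd (b :: a)).
Qed.

(** What stops the leftward copy of the numerator: the home cell, or a blank left by [Strip]. *)
Definition wall (l : seq (symbol unit)) : bool :=
  if head None l is Some (inl _) then false else true.

Lemma digits_run l a b r o : wall l -> exists t1,
  run (conf (inr Digit) t0 (bit_cells a ++ l, bit_cell b :: r) (written o))
      (conf (inr Halt) t0 t1
         ([::], bit_cell false :: bit_cells (mark (rev (b :: a)) ++ o))).
Proof.
move=> wl; elim: a b r o => [|c a IHa] b r o.
  exists (behead l, [:: head None l, bit_cell b & r]).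
  apply: run_step; first by [].
  rewrite keep0 ?keep_written act_written.
  apply: run_step; first by [].
  rewrite keep0 act_written.
  have -> : act (bit_cells [::] ++ l, bit_cell b :: r)
    (read (bit_cells [::] ++ l, bit_cell b :: r), MoveLeft) =
    (behead l, [:: head None l, bit_cell b & r]) by [].
  apply: (@run_step n _ _ _ _ (inr Halt) (read t0, Stay)
    (head None l, Stay) (bit_cell false, Stay)).
    by move: wl; rewrite /wall /=; case: (head None l) => [[]|].
  by rewrite keep0; exact: run_refl.
have [t1 run'] := IHa c (bit_cell b :: r) (true :: b :: o).
exists t1; apply: run_step; first by [].
rewrite keep0 ?keep_written act_written.
apply: run_step; first by [].
rewrite keep0 act_written.
have -> : mark (rev [:: b, c & a]) ++ o = mark (rev (c :: a)) ++ [:: true, b & o].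
  by rewrite rev_cons /mark map_rcons flatten_rcons -catA.
exact: run'.
Qed.

Lemma output_run L : exists t1 s z d k,
  [/\ L = s ++ nseq k false, s = nseq z false ++ d, last true s, head true d &
  run (conf (inr ToEnd) t0 ([::], home_cell :: bit_cells L) (written [::]))
      (conf (inr Halt) t0 t1 ([::], bit_cells
        (false :: mark (if d is [::] then [:: false] else d) ++
         false :: enc_nat (2 ^ size s))))].
Proof.
have [k [a [j [ea a1 run1]]]] := @trim_run (rev L) 0 (written [::]) isT.
have [z [d [i [ed d1 run2]]]] :=
  @strip_run (rev a) 0 (blanks j.+1) (written (false :: enc_nat (2 ^ size a))) isT.
have eL : L = rev a ++ nseq k false by rewrite -[L]revK ea rev_cat rev_nseq.
have wl : wall (blanks i ++ [:: home_cell]) by case: (i).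
have [t1 run3] : exists t1,
  run (conf (inr Strip) t0 (blanks i ++ [:: home_cell], bit_cells d ++ blanks j.+1)
         (written (false :: enc_nat (2 ^ size a))))
      (conf (inr Halt) t0 t1 ([::], bit_cells
        (false :: mark (if d is [::] then [:: false] else d) ++
         false :: enc_nat (2 ^ size a)))).
  (* When no digit is left, [Strip] meets a blank and writes a single 0, because the code of 0 has
     one digit. *)
  case: d d1 {ed run2} => [_|[] // d _].
    have [t1 run3] := @digits_run _ [::] false (blanks j)
      (false :: enc_nat (2 ^ size a)) wl.
    exists t1; apply: run_step; first by [].
    by rewrite keep0 ?keep_written; exact: run3.
  have run3 := @tolast_run (blanks i ++ [:: home_cell]) [::] (true :: d) j.+1
    (written (false :: enc_nat (2 ^ size a))) isT.
  case er: (rev (true :: d)) run3 => [|b a'] run3.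
    by have := congr1 size er; rewrite size_rev.
  have [t1 run4] := @digits_run _ a' b (blanks j.+1)
    (false :: enc_nat (2 ^ size a)) wl.
  exists t1; apply: run_step; first by [].
  rewrite keep0 keep_written; apply: run_trans run3 _.
  apply: run_step; first by [].
  rewrite keep0 keep_written cats0.
  by rewrite -er revK in run4; exact: run4.
exists t1, (rev a), z, d, k; split=> //.
  by case: a a1 {ea eL run2 run3 run1 ed} => // b a /= ->; rewrite rev_cons last_rcons.
apply: run_step; first by [].
rewrite keep0 ?keep_written.
apply: run_trans (@toend_run [::] L (written [::]) isT) _; rewrite cats0.
apply: run_trans run1 _.
apply: (@run_step n _ _ _ _ (inr DenMark) (read t0, Stay)
  (read (at_top a (blanks j.+1)), Stay) (bit_cell false, MoveLeft)).
  by case: a a1 {ea eL run2 run3 ed} => // -[].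
rewrite keep0 act_written act_keep; last by case: (a).
apply: run_trans (denominator_run _ _ _) _.
(* From right to left: the leading one of the denominator, its marker, and the [false] that ends the
   numerator. *)
do 3 (apply: run_step; first by []).
rewrite !keep0 !act_written size_rev.
have -> : [:: false, true, true & mark (nseq (size a) false) ++ [:: false]] =
  false :: enc_nat (2 ^ size a) by rewrite enc_natE bits_expn.
by apply: run_trans run2 _; exact: run3.
Qed.

End Output.

Lemma frac_nat_of_bits s : frac s = (nat_of_bits s)%:R / 2 ^+ size s.
Proof.
elim/last_ind: s => [|s b IHs]; first by rewrite mul0r.
rewrite -cats1 frac_cat IHs cats1 nat_of_bits_rcons size_rcons natrD -mul2n natrM.
by rewrite exprS exprVn /=; field; rewrite expf_neq0.
Qed.

Lemma nat_of_bits_strip z d : nat_of_bits (nseq z false ++ d) = nat_of_bits d.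
Proof. by rewrite /nat_of_bits foldl_cat; congr foldl; elim: z. Qed.

(** Either [s] is empty or its last digit makes the numerator odd, so the fraction over [2 ^ size s]
    is irreducible; without leading zeros, [d] is the expansion of a positive numerator. *)
Lemma enc_rat_frac s z d :
    s = nseq z false ++ d -> last true s -> head true d ->
  enc_rat (frac s) =
  false :: mark (if d is [::] then [:: false] else d) ++ false :: enc_nat (2 ^ size s).
Proof.
move=> es s1 d1; set N := nat_of_bits d; set M := (2 ^ size s)%N.
have M_gt0 : (0 < M)%N by rewrite expn_gt0.
have cop : coprime N M.
  rewrite /N -(nat_of_bits_strip z) -es /M.
  case/lastP: s s1 {es M M_gt0} => [|s b]; first by rewrite expn0 coprimen1.
  rewrite last_rcons nat_of_bits_rcons => ->.
  by rewrite coprimeXr // coprimen2 add1n /= odd_double.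
have -> : frac s = N%:Z%:~R / M%:Z%:~R.
  by rewrite frac_nat_of_bits {1}es nat_of_bits_strip -!pmulrn natrX.
rewrite -[enc_rat _]cats0 enc_rat_cat coprimeq_num // coprimeq_den // gtr0_sg //.
rewrite mul1r eqz_nat (gtn_eqF M_gt0) !absz_nat /=.
congr (_ :: mark _ ++ _); rewrite /N.
by case: d d1 {es N cop} => [|[] d] // _; rewrite nat_of_bitsK.
Qed.

(** * Correctness of the machine *)

Section Computes.
Variable n : nat.

Definition point_weight (q : 'rV[rat]_n.+1) : rat :=
  2^-1 * weight (scan_start n) (enc_point q).

Lemma point_weight_ge0 q : 0 <= point_weight q.
Proof. by rewrite mulr_ge0 // weight_ge0. Qed.

(** The Kraft bound at [scan_start] is 1. The factor 1/2 in [point_weight] keeps every partial sum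
    strictly below 1, so tape 1 never overflows. *)
Lemma sum_point_weight (s : seq 'rV[rat]_n.+1) :
  uniq s -> \sum_(q <- s) point_weight q <= 2^-1.
Proof.
move=> us; rewrite -mulr_sumr ler_piMr //.
rewrite -(big_map (@enc_point n.+1) xpredT (weight (scan_start n))).
apply: (@kraft n (scan_start n)).
  by rewrite map_inj_uniq //; exact: enc_point_inj.
by apply/allP => _ /mapP[q _ ->]; exact: accepts_enc_point.
Qed.

Lemma items_run (s : seq 'rV[rat]_n.+1) y l L t2 :
    t2.2 != [::] -> frac L + \sum_(q <- s) point_weight q < 1 ->
  exists l' L',
    run (@conf n (inr Item) (l, bit_cells (enc_seq (@enc_point n.+1) s ++ y))
           ([::], home_cell :: bit_cells L) t2)
        (conf (inr Item) (l', bit_cells (false :: y))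
           ([::], home_cell :: bit_cells L') t2) /\
    frac L' = frac L + \sum_(q <- s) point_weight q.
Proof.
move=> t2K; elim: s l L => [|q s IHs] l L.
  by exists l, L; rewrite big_nil addr0; split=> //; exact: run_refl.
rewrite big_cons addrA => lt1.
(* The code of a list ends with [false], so a listed cell always follows the point being read, as
   [item_run] demands. *)
have [b [x ex]] : exists b x, enc_seq (@enc_point n.+1) s ++ y = b :: x.
  by case: (s) => [|? ?]; eexists; eexists; reflexivity.
have lt1' : frac L + point_weight q < 1.
  by apply: le_lt_trans lt1; rewrite lerDl sumr_ge0 // => ? _; exact: point_weight_ge0.
have [l1 [L1 [run1 e1]]] := item_run b x l t2K (accepts_enc_point q) lt1'.
have [|l2 [L2 [run2 e2]]] := IHs l1 L1; first by rewrite e1.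
exists l2, L2; rewrite e2 e1; split=> //; apply: run_trans run2.
rewrite ex; have -> // : enc_seq (@enc_point n.+1) (q :: s) ++ y =
  true :: enc_point q ++ b :: x.
by rewrite -ex /enc_seq /= -!catA.
Qed.

Lemma weight_machine_computes (s : seq 'rV[rat]_n.+1) (t : nat) : uniq s ->
  computes (weight_machine n) (enc_seq (@enc_point n.+1) s ++ enc_nat t)
    (enc_rat (\sum_(q <- s) point_weight q)).
Proof.
move=> us.
have lt1 : frac [::] + \sum_(q <- s) point_weight q < 1.
  by rewrite add0r (le_lt_trans (sum_point_weight us)).
have [l [L [run1 eL]]] :=
  @items_run s (enc_nat t) [::] [::] (written [::]) isT lt1.
have [|t1 [a [z [d [k [eLa ea a1 d1 run2]]]]]] :=
  @output_run n (l, bit_cells (false :: enc_nat t)) _ L; first by [].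
have efrac : frac L = frac a by rewrite eLa frac_cat frac_nseq0 mulr0 addr0.
rewrite add0r in eL.
rewrite -eL efrac (enc_rat_frac ea a1 d1).
pose final := @conf n (inr Halt) (l, bit_cells (false :: enc_nat t)) t1
  ([::], bit_cells (false :: mark (if d is [::] then [:: false] else d) ++
                    false :: enc_nat (2 ^ size a))).
have [u eu] : run (@conf n (inr Init)
    ([::], bit_cells (enc_seq (@enc_point n.+1) s ++ enc_nat t))
    ([::], [::]) ([::], [::])) final.
  (* Besides marking the home cell, [Init] lists the scanned blank of tape 2, which thereby becomes
     [written [::]]. *)
  apply: run_step; first by [].
  rewrite act_keep; last by case: (s).
  apply: run_trans run1 _.
  by apply: run_step; first by []; exact: run2.
exists u, final; split.
- rewrite -eu; congr (iter u _ (Some (_, _))).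
  by apply/ffunP => i; rewrite !ffunE; case: i => -[|[|[|//]]] ?.
- by rewrite step_conf.
- rewrite /output /= ffunE.
  have outE o : @leading_bits (weight_machine n) (bit_cells o) = o.
    by elim: o => //= b o ->.
  by rewrite -[RHS]outE.
Qed.

Lemma computable_weight : computable (fun (A : {fset 'rV[rat]_n.+1}) (_ : nat) =>
  \sum_(q <- enum_fset A) point_weight q).
Proof.
exists (weight_machine n) => A s t sA.
rewrite -(perm_big _ sA) /=; apply: weight_machine_computes.
by rewrite (perm_uniq sA) fset_uniq.
Qed.

End Computes.

(** * The additive outer measure *)

Local Open Scope classical_set_scope.

Section WeightMeasure.
Variables (R : realType) (n : nat) (w : 'rV[rat]_n -> rat).
Hypothesis w_ge0 : forall q, 0 <= w q.

Let wR q : \bar R := (ratr (w q))%:E.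

Let wR_ge0 q : (0 <= wR q)%E. Proof. by rewrite lee_fin ler0q. Qed.

Definition weight_measure (E : set 'rV[R]_n) : \bar R :=
  \esum_(q in @rat_point R n @^-1` E) (ratr (w q))%:E.

Let wm0 : weight_measure set0 = 0%E.
Proof. by rewrite /weight_measure preimage_set0 esum_set0. Qed.

Let wm_ge0 E : (0 <= weight_measure E)%E.
Proof. by apply: esum_ge0 => q _; exact: wR_ge0. Qed.

Lemma le_weight_measure E F : E `<=` F -> (weight_measure E <= weight_measure F)%E.
Proof.
move=> EF; rewrite /weight_measure [leRHS](esumID (@rat_point R n @^-1` E));
  last by move=> q _; exact: wR_ge0.
rewrite setIidr; last by move=> q /EF.
by rewrite leeDl // esum_ge0 // => q _; exact: wR_ge0.
Qed.

(** The union is made disjoint with [seqDU]; the sum is additive over the disjoint pieces, and each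
    piece lies in the corresponding [F i]. *)
Let wm_subadditive : sigma_subadditive weight_measure.
Proof.
move=> F; rewrite seqDU_bigcup_eq /weight_measure preimage_bigcup.
have tF : trivIset [set: nat] (fun i => @rat_point R n @^-1` seqDU F i).
  move=> i j _ _ [q [Fi Fj]].
  by apply: (@trivIset_seqDU _ F i j I I); exists (rat_point R q).
rewrite (esum_bigcupT _ _ tF wR_ge0).
rewrite nneseries_esumT; last by move=> i; exact: wm_ge0.
apply: le_esum => i _; exact: (le_weight_measure (@subset_seqDU _ F i)).
Qed.

HB.instance Definition _ := isOuterMeasure.Build R 'rV[R]_n weight_measure
  wm0 wm_ge0 le_weight_measure wm_subadditive.

Lemma rat_point_inj : injective (@rat_point R n).
Proof.
by move=> p q /rowP pq; apply/rowP => i; have := pq i; rewrite !mxE => /fmorph_inj.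
Qed.

Lemma rat_point_imageK (X : set 'rV[rat]_n) :
  @rat_point R n @^-1` (@rat_point R n @` X) = X.
Proof. by apply/seteqP; split=> [q [p Xp /rat_point_inj <-]|q Xq] //; exists q. Qed.

Lemma weight_measure_fset (A : {fset 'rV[rat]_n}) :
  weight_measure (@rat_fset R n A) = (ratr (\sum_(q <- enum_fset A) w q))%:E.
Proof.
rewrite /weight_measure rat_point_imageK.
rewrite esum_fset //; last by move=> ? ?; exact: wR_ge0.
by rewrite fsbig_finite //= set_fsetK rmorph_sum -sumEFin.
Qed.

Lemma weight_measure_uniq (s : seq 'rV[rat]_n) : uniq s ->
  weight_measure (@rat_point R n @` [set` s]) = (ratr (\sum_(q <- s) w q))%:E.
Proof.
move=> us; have -> : [set` s] = [set` [fset q in s]%fset].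
  by apply/seteqP; split=> q; rewrite /= inE.
rewrite weight_measure_fset; congr (ratr _)%:E; apply: perm_big.
by apply: uniq_perm => // q; rewrite inE.
Qed.

Hypothesis sum_w : exists c, forall s, uniq s -> \sum_(q <- s) w q <= c.

Lemma weight_total : (\esum_(q in [set: 'rV[rat]_n]) wR q < +oo)%E.
Proof.
have [c wc] := sum_w.
apply: (@le_lt_trans _ _ (ratr c)%:E); last exact: ltry.
apply: ge_ereal_sup => _ [X [finX _]] <-.
rewrite fsbig_finite //= sumEFin lee_fin -rmorph_sum ler_rat.
by apply: wc; exact: fset_uniq.
Qed.

Lemma weight_measure_strongly_finite :
  strongly_finite (weight_measure : {outer_measure set 'rV[R]_n -> \bar R}).
Proof.
split.
  by rewrite /supported_on_rat /= /weight_measure esum1 // => q [] /=; exists q.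
apply: le_lt_trans weight_total; apply: le_esum => q _.
have -> : [set rat_point R q] = @rat_fset R n [fset q]%fset.
  by rewrite /rat_fset set_fset1 image_set1.
by rewrite /= weight_measure_fset big_seq_fset1.
Qed.

Lemma weight_measure_finitely_supported :
  finitely_supported_on_rat (weight_measure : {outer_measure set 'rV[R]_n -> \bar R}).
Proof.
move=> e e0.
have fin : \esum_(q in [set: 'rV[rat]_n]) wR q \is a fin_num.
  by rewrite ge0_fin_numE ?weight_total // esum_ge0.
(* The finite set [X] carries all but [e] of the total weight; the measure of its complement is
   exactly the remainder. *)
have [_ [X [finX _]] <- ltX] := ub_ereal_sup_adherent e0 fin.
exists (fset_set X).
have := fin; have := ltX; rewrite -/(esum _ _) /=.
have -> : (\esum_(q in [set: 'rV[rat]_n]) wR q =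
  \sum_(q \in X) wR q + weight_measure (~` @rat_fset R n (fset_set X)))%E.
  rewrite (esumID X) // setTI esum_fset //; congr (_ + esum _ _)%E.
  by rewrite setTI -preimage_setC rat_point_imageK fset_setK.
have : (\sum_(q \in X) wR q)%E \is a fin_num.
  by rewrite fsbig_finite //= sumEFin.
case: (\sum_(q \in X) wR q)%E => // r _.
by case: (weight_measure _) => // t + _; rewrite -!EFinD !lte_fin; lra.
Qed.

Lemma weight_measure_lower_semicomputable :
  computable (fun (A : {fset 'rV[rat]_n}) (_ : nat) => \sum_(q <- enum_fset A) w q) ->
  lower_semicomputable (weight_measure : {outer_measure set 'rV[R]_n -> \bar R}).
Proof.
move=> w_comp; split; first exact: weight_measure_finitely_supported.
exists (fun A _ => \sum_(q <- enum_fset A) w q); split=> //.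
- by move=> A _; apply: sumr_ge0.
- by move=> A s t _; rewrite /= weight_measure_fset.
- by move=> A; rewrite /= weight_measure_fset; apply: cvg_cst.
Qed.

End WeightMeasure.

(** * Counting simple points *)

Fixpoint words (k : nat) : seq (seq bool) :=
  if k is k'.+1 then
    [seq true :: s | s <- words k'] ++ [seq false :: s | s <- words k']
  else [:: [::]].

Lemma mem_words k s : (s \in words k) = (size s == k).
Proof.
elim: k s => [|k IHk] [|b s] //=.
  by rewrite mem_cat; apply/negbTE; rewrite negb_or; apply/andP; split;
    apply/mapP => -[].
rewrite mem_cat eqSS -IHk; case: b.
  rewrite mem_map; last by move=> ? ? [].
  by case: (_ \in words k) => //=; apply/mapP => -[].
rewrite orbC mem_map; last by move=> ? ? [].
by case: (_ \in words k) => //=; apply/mapP => -[].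
Qed.

Lemma words_uniq k : uniq (words k).
Proof.
elim: k => //= k IHk; rewrite cat_uniq !map_inj_uniq ?IHk; try by move=> ? ? [].
rewrite andbT; apply/hasPn => _ /mapP[s _ ->]; by apply/mapP => -[].
Qed.

Lemma size_words k : size (words k) = (2 ^ k)%N.
Proof. by elim: k => //= k IHk; rewrite size_cat !size_map IHk expnS mul2n addnn. Qed.

(** Each digit contributes a factor [1 + 1/2]. *)
Lemma sum_words k :
  \sum_(s <- words k) (2^-1 : rat) ^+ count id s = (3 / 2) ^+ k.
Proof.
elim: k => [|k IHk]; first by rewrite big_seq1.
rewrite /= big_cat !big_map /=.
under eq_bigr do rewrite exprD expr1.
under [X in _ + X]eq_bigr do rewrite add0n.
by rewrite -mulr_sumr IHk exprS; field.
Qed.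

Section Complexity.
Variables (U : turing_machine) (n : nat).

Lemma computes_inj (x y z : seq bool) :
  computes U x y -> computes U x z -> y = z.
Proof.
(* Once halted, a run has no later configuration, so two halting times coincide. *)
have halt t d c : iter t (obind (@step U)) (Some c) = Some d -> forall s e,
    step d = None -> iter (s + t) (obind (@step U)) (Some c) = Some e -> s = 0%N.
  move=> ed s e hd; rewrite iterD ed; case: s => // s; rewrite iterSr /= hd.
  by have -> // : iter s (obind (@step U)) None = None by elim: s => //= s ->.
move=> [t [c [ec hc <-]]] [s [d [ed hd <-]]].
have [ts|st] := leqP t s.
  rewrite -(subnK ts) in ed; have e0 := halt _ _ _ ec _ _ hc ed.
  by move: ed; rewrite e0 add0n ec => -[->].
rewrite -(subnK (ltnW st)) in ec; have e0 := halt _ _ _ ed _ _ hd ec.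
by move: ec; rewrite e0 add0n ed => -[->].
Qed.

Lemma K_pointP (q : 'rV[rat]_n) k : K_point U q = Some k ->
  exists p, computes U p (enc_point q) /\ size p = k.
Proof. by move=> /min_natP[]. Qed.

(** Distinct points have distinct programs. A program [p] shorter than [i] is padded to [0...01p] of
    length exactly [i], and this padding is injective. *)
Lemma size_simple_points i (s : seq 'rV[rat]_n) : uniq s ->
    (forall q, q \in s -> exists2 k, K_point U q = Some k & (k < i)%N) ->
  (size s <= 2 ^ i)%N.
Proof.
move=> us sK.
have {sK} [f fP] : exists f : 'rV[rat]_n -> seq bool, forall q, q \in s ->
    computes U (f q) (enc_point q) /\ (size (f q) < i)%N.
  have : forall q, exists p, q \in s ->
      computes U p (enc_point q) /\ (size p < i)%N.
    move=> q; case: (boolP (q \in s)) => [/sK[k /K_pointP[p [pq <-]] ki]|_].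
      by exists p.
    by exists [::].
  by case/choice=> f fP; exists f.
pose pad (p : seq bool) := nseq (i - (size p).+1) false ++ true :: p.
have pad_inj p p' : pad p = pad p' -> p = p'.
  rewrite /pad; elim: (i - _)%N (i - _)%N => [|j IHj] [|j'] //=; first by case.
  by case=> /IHj.
have fs_inj : {in s &, injective (pad \o f)}.
  move=> q q' /fP[cq _] /fP[cq' _] /= /pad_inj ef.
  by apply: enc_point_inj; apply: (computes_inj cq); rewrite ef.
rewrite -(size_map (pad \o f)) -size_words; apply: uniq_leq_size.
  by rewrite map_inj_in_uniq.
move=> _ /mapP[q /fP[_ fi] ->].
by rewrite mem_words /= size_cat size_nseq /= subnK.
Qed.

End Complexity.

(** Bernoulli's inequality for [1 + 1/8]. *)
Lemma bernoulli8 i : i%:R / 8 <= (9 / 8) ^+ i - 1 :> rat.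
Proof.
elim: i => [|i IHi]; first by rewrite mul0r subrr.
rewrite exprS -natr1; have : 0 <= i%:R :> rat by [].
move: IHi; lra.
Qed.

(** * Heavy sets without simple points *)

Section ComplexPoints.
Variables (U : turing_machine) (n : nat).

(** A point without any program has infinite complexity and is never simple. *)
Definition simpler (i : nat) (q : 'rV[rat]_n.+1) : bool :=
  if K_point U q is Some k then (k < i)%N else false.

Definition word_point (s : seq bool) : 'rV[rat]_n.+1 :=
  nat_point n (nat_of_bits (true :: s)).

Lemma word_point_inj : injective word_point.
Proof.
by move=> s t /nat_point_inj/(congr1 bits); rewrite !nat_of_bitsK => -[].
Qed.

Definition complex_points (i : nat) : seq 'rV[rat]_n.+1 :=
  [seq q <- [seq word_point s | s <- words (2 * i)] | ~~ simpler i q].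

Lemma complex_points_uniq i : uniq (complex_points i).
Proof.
by rewrite filter_uniq // map_inj_uniq ?words_uniq //; exact: word_point_inj.
Qed.

Lemma complex_points_heavy : exists2 C : rat, 0 < C & forall i,
  C * i%:R / 2 ^+ i <= \sum_(q <- complex_points i) point_weight q.
Proof.
have [c costE] := cost_nat_point n.
(* The 16 is the 2 from [point_weight] times the 8 of [bernoulli8]. *)
exists (2^-1 ^+ c / 16) => [|i]; first by rewrite divr_gt0 // exprn_gt0.
have wE s : s \in words (2 * i) -> point_weight (word_point s) =
    2^-1 ^+ c / 2 * 2^-1 ^+ (2 * i) * 2^-1 ^+ count id s.
  rewrite mem_words => /eqP sz.
  by rewrite /point_weight /weight costE sz !exprD; ring.
rewrite /complex_points; set P := [seq word_point s | s <- _].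
have sumP : \sum_(q <- P) point_weight q = 2^-1 ^+ c / 2 * (9 / 16) ^+ i.
  rewrite big_map big_seq (eq_bigr _ wE) -big_seq -mulr_sumr sum_words.
  have e : 2^-1 ^+ (2 * i) * (3 / 2) ^+ (2 * i) = (9 / 16) ^+ i :> rat.
    by rewrite -exprMn exprM; congr (_ ^+ _); field.
  by rewrite -e mulrA.
(* At most [2^i] simple points, each of weight at most [2^-c / 2 * 4^-i]. *)
have sum_simple : \sum_(q <- P | simpler i q) point_weight q <=
    2^-1 ^+ c / 2 * 2^-1 ^+ i.
  rewrite -big_filter; set S := [seq q <- P | _].
  have leS : (size S <= 2 ^ i)%N.
    apply: (@size_simple_points U) => [|q].
      by rewrite filter_uniq // map_inj_uniq ?words_uniq //; exact: word_point_inj.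
    rewrite mem_filter /simpler; case: (K_point U q) => // k /andP[ki _].
    by exists k.
  apply: (@le_trans _ _ (\sum_(q <- S) 2^-1 ^+ c / 2 * 2^-1 ^+ (2 * i))).
    rewrite big_seq [leRHS]big_seq; apply: ler_sum => q.
    rewrite mem_filter => /andP[_ /mapP[s /wE + ->]] => ->.
    rewrite ler_piMr // ?exprn_ile1 // ?mulr_ge0 ?exprn_ge0 //.
  rewrite big_const_seq count_predT iter_addr_0 -[_ *+ size S]mulr_natr -[leLHS]mulrA.
  rewrite ler_wpM2l ?divr_ge0 ?exprn_ge0 //.
  apply: (@le_trans _ _ (2^-1 ^+ (2 * i) * (2 ^ i)%:R)).
    by rewrite ler_wpM2l ?exprn_ge0 // ler_nat.
  by rewrite mul2n -addnn exprD natrX exprVn mulfVK // expf_neq0.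
rewrite big_filter.
have := sumP; rewrite (bigID (simpler i)) /=.
(* The common factor [2^-i] is isolated: what is left after removing the simple points is at least
   [2^-c / 2 * 2^-i * ((9/8)^i - 1)]. *)
have -> : (9 / 16) ^+ i = (9 / 8) ^+ i * 2^-1 ^+ i :> rat.
  by rewrite -exprMn; congr (_ ^+ _); field.
have := bernoulli8 i; have := sum_simple.
set A := \sum_(q <- P | _) _; set B := \sum_(q <- P | _) _.
set x := (9 / 8) ^+ i; rewrite -exprVn; set y := 2^-1 ^+ i; set z := 2^-1 ^+ c.
have y0 : 0 <= y by rewrite exprn_ge0.
have z0 : 0 <= z by rewrite exprn_ge0.
move=> leA b8 eAB.
have := mulr_ge0 (mulr_ge0 y0 z0) (_ : 0 <= x - 1 - i%:R / 8).
rewrite subr_ge0 => /(_ b8); nra.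
Qed.

Lemma kappa_complex_points (R : realType) i :
  (@kappa U R n.+1 (@rat_point R n.+1 @` [set` complex_points i]) <= (2 ^- i)%:E)%E.
Proof.
rewrite /kappa; case EK: K_set => [k|]; last by rewrite lee_fin invr_ge0 exprn_ge0.
have [[q [[p pG /rat_point_inj epq] Kq]] _] := (iffLR (min_natP _ _)) EK.
rewrite lee_fin lef_pV2 ?posrE ?exprn_gt0 // ler_weXn2l ?ler1n //.
move: pG; rewrite epq /= mem_filter => /andP[+ _].
by rewrite /simpler Kq -leqNgt.
Qed.

End ComplexPoints.

(** Cancelling [2^-i] would give [x * i <= 1] for every [i], which fails for an [i] above
    [1 / x]. *)
Lemma scaled_multiples_unbounded (R : archiRealFieldType) (x : R) :
  0 < x -> ~ (forall i, x * i%:R / 2 ^+ i <= 2 ^- i).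
Proof.
move=> x_gt0 /(_ (Num.bound x^-1)); set i := Num.bound _.
rewrite ler_pdivrMr ?exprn_gt0 // mulVf ?expf_neq0 // -ler_pdivlMl // mulr1.
by apply/negP; rewrite -ltNge archi_boundP // invr_ge0 ltW.
Qed.

Theorem lemma4p4 (R : realType) (n : nat) (hn : (1 <= n)%N)
    (U : turing_machine) (hU : universal_prefix_machine U) :
  ~ globally_optimal (@kappa U R n : {outer_measure set 'rV[R]_n -> \bar R}%R).
Proof.
case: n hn => // n _ [_ _ kappa_max].
have w_bound : exists c, forall s : seq 'rV[rat]_n.+1, uniq s ->
    \sum_(q <- s) point_weight q <= c by exists 2^-1; exact: sum_point_weight.
have [b [b_gt0 nu_le]] := kappa_max _
  (weight_measure_strongly_finite R (@point_weight_ge0 n) w_bound)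
  (weight_measure_lower_semicomputable R (@point_weight_ge0 n) w_bound
    (computable_weight n)).
have [C C_gt0 heavy] := complex_points_heavy U n.
(* On the complex points, optimality gives [b * C * i * 2^-i <= b * nu <= kappa <= 2^-i], where [nu]
   is the weight measure. *)
have bC_gt0 : 0 < b * ratr C by rewrite mulr_gt0 // ltr0q.
apply: (scaled_multiples_unbounded bC_gt0) => i.
have := le_trans (nu_le _) (@kappa_complex_points U n R i).
rewrite /= weight_measure_uniq ?complex_points_uniq //; last exact: point_weight_ge0.
move=> le_b; apply: le_trans (_ : _ <= b * ratr (C * i%:R / 2 ^+ i)) _.
  by rewrite fmorph_div rmorphM rmorphXn /= !ratr_nat !mulrA.
apply: le_trans (_ : _ <= b * ratr (\sum_(q <- complex_points U n i) point_weight q)) _.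
  by rewrite ler_pM2l // ler_rat; exact: heavy.
by rewrite -lee_fin; exact: le_b.
Qed.
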